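(* Let $f$ be a power series with $f(0)=0$ and $f'(0)\equiv1\pmod 2$. The Riordan graph $G=G_n(f',f)$ is ie-decomposable if and only if its binary $A$-sequence is of the form $(1,1,a_2,0,a_4,0,a_6,0,\ldots)$ where $a_{2i}$ is $0$ or $1$ for $i\ge1$, i.e. its generating function $A(t)$ satisfies $A'(t)\equiv1$.
   Context: Power series are in the variable $t$ with coefficients in $\mathbb{Z}$ (or $\mathbb{Z}_2$); $\equiv$ means congruence mod $2$ (coefficientwise for power series); $'$ is the formal derivative; $[t^k]u$ is the coefficient of $t^k$ in $u$. For power series $g,f$ with $f(0)=0$, the Riordan graph $G_n(g,f)$ is the simple graph on the vertex set $\{1,\dots,n\}$ in which, for $i>j\ge1$, the vertices $i$ and $j$ are adjacent if and only if $[t^{i-2}]\,g f^{\,j-1}\equiv 1$. It is proper if the matrix of the coefficients $[t^i]gf^j$ mod $2$, $0\le i,j\le n-2$, is a proper (i.e. invertible) binary Riordan matrix, which means $g(0)\equiv f'(0)\equiv1$. The binary $A$-sequence of a proper Riordan graph $G_n(g,f)$ is the unique $(0,1)$-sequence whose generating function $A(t)$ satisfies $f\equiv tA(f)$; its first term is $1$. A proper Riordan graph $G_n(g,f)$, with odd vertex set $V_o$ and even vertex set $V_e$, is ie-decomposable if the induced subgraph $\langle V_o\rangle$ is a null graph (no edges) and the induced subgraph $\langle V_e\rangle$ is isomorphic (as a graph) to $G_{\lfloor n/2\rfloor}(g,f)$.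
   Formalization: ''G_n(f',f) is ie-decomposable'' is taken to mean for every n ≥ 1; for a single fixed n the ''only if'' direction is false (e.g. n = 1, f = t, where A = 1), since G_n depends on only finitely many coefficients of f. *)

(* Defs.v *)
From HB Require Import structures.
From mathcomp Require Import all_boot all_order all_algebra.

Set Implicit Arguments.
Unset Strict Implicit.
Unset Printing Implicit Defensive.

Import Order.TTheory GRing.Theory Num.Theory.
Local Open Scope ring_scope.

Definition eqmod2 (x y : int) : bool := (x == y %[mod 2])%Z.

(* A formal power series is its coefficient sequence: [t^k]u is [u k]. *)
Definition fps := nat -> int.

Definition fps_eqmod2 (u v : fps) : Prop := forall k, eqmod2 (u k) (v k).

Definition fps_one : fps := fun k => (k == 0%N)%:R.

Definition fps_mul (u v : fps) : fps :=
  fun k => \sum_(i < k.+1) u i * v (k - i)%N.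

Definition fps_exp (u : fps) (j : nat) : fps := iter j (fps_mul u) fps_one.

Definition fps_shift (u : fps) : fps := fun k => if k is k'.+1 then u k' else 0.

Definition fps_deriv (u : fps) : fps := fun k => u k.+1 *+ k.+1.

(* u(f).  Meaningful only when f(0) = 0: then f^j has order at least j, so
   that the terms j > k do not contribute to the coefficient of t^k. *)
Definition fps_comp (u f : fps) : fps :=
  fun k => \sum_(j < k.+1) u j * fps_exp f j k.

Record sgraph := SGraph {
  vertex :> finType;
  adj : rel vertex;
  adj_sym : symmetric adj;
  adj_irrefl : irreflexive adj }.

Definition null_graph (G : sgraph) : Prop := forall x y : G, ~~ adj x y.

Definition graph_iso (G H : sgraph) : Prop :=
  exists2 h : G -> H, bijective h & forall x y, adj (h x) (h y) = adj x y.

Section Induced.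
Variables (G : sgraph) (S : {set G}).

Definition induced_adj : rel {x : G | x \in S} :=
  fun x y => adj (val x) (val y).

Lemma induced_adj_sym : symmetric induced_adj.
Proof. by move=> x y; apply: adj_sym. Qed.

Lemma induced_adj_irrefl : irreflexive induced_adj.
Proof. by move=> x; apply: adj_irrefl. Qed.

Definition induced : sgraph := SGraph induced_adj_sym induced_adj_irrefl.
End Induced.

(* The vertex set {1, ..., n} is represented by 'I_n, through this labelling. *)
Definition label (n : nat) (x : 'I_n) : nat := x.+1.

(* Adjacency of the labels i > j >= 1; in that range the truncated
   subtractions are exact. *)
Definition riordan_edge (g f : fps) (i j : nat) : bool :=
  eqmod2 (fps_mul g (fps_exp f (j - 1)%N) (i - 2)%N) 1.

Section RiordanGraph.
Variables (n : nat) (g f : fps).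

Definition riordan_adj : rel 'I_n := fun x y =>
     (label y < label x)%N && riordan_edge g f (label x) (label y)
  || (label x < label y)%N && riordan_edge g f (label y) (label x).

Lemma riordan_adj_sym : symmetric riordan_adj.
Proof. by move=> x y; rewrite /riordan_adj orbC. Qed.

Lemma riordan_adj_irrefl : irreflexive riordan_adj.
Proof. by move=> x; rewrite /riordan_adj ltnn. Qed.

Definition riordan_graph : sgraph := SGraph riordan_adj_sym riordan_adj_irrefl.

Definition odd_vertices : {set riordan_graph} :=
  [set x : 'I_n | odd (label x)].

Definition even_vertices : {set riordan_graph} :=
  [set x : 'I_n | ~~ odd (label x)].
End RiordanGraph.

Definition riordan_proper (g f : fps) : Prop :=
  eqmod2 (g 0%N) 1 /\ eqmod2 (fps_deriv f 0%N) 1.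

Definition ie_decomposable (n : nat) (g f : fps) : Prop :=
  [/\ riordan_proper g f,
      null_graph (induced (odd_vertices n g f))
    & graph_iso (induced (even_vertices n g f)) (riordan_graph n./2 g f)].

Definition binary_A_sequence (f A : fps) : Prop :=
  (forall k, A k = 0 \/ A k = 1) /\
  fps_eqmod2 f (fps_shift (fps_comp A f)).

(* (1, 1, a_2, 0, a_4, 0, a_6, 0, ...) *)
Definition ie_form (A : fps) : Prop :=
  [/\ A 0%N = 1, A 1%N = 1
    & forall i, (1 <= i)%N ->
        (A i.*2 = 0 \/ A i.*2 = 1) /\ A i.*2.+1 = 0].

Lemma fps_exp_small (f : fps) (j k : nat) :
  f 0%N = 0 -> (k < j)%N -> fps_exp f j k = 0.
Proof.
move=> f0; elim: j k => [//|j IHj] k; rewrite ltnS => lekj.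
rewrite /fps_exp iterS /fps_mul big1 // => [[i /= lti]] _.
case: i lti => [|i] lti; first by rewrite f0 mul0r.
rewrite -/(fps_exp f j) IHj ?mulr0 //.
by apply: leq_trans lekj; rewrite ltn_subrL /=; case: k lti.
Qed.

Lemma fps_exp_diag (f : fps) (j : nat) :
  f 0%N = 0 -> fps_exp f j j = f 1%N ^+ j.
Proof.
move=> f0; elim: j => [//|j IHj].
rewrite /fps_exp iterS /fps_mul -/(fps_exp f j).
rewrite big_ord_recl f0 mul0r add0r big_ord_recl /=.
rewrite subSS subn0 IHj exprS big1 ?addr0 // => i _.
rewrite fps_exp_small ?mulr0 //= /bump /= subSS ltn_subrL /=.
exact: leq_ltn_trans (ltn_ord i).
Qed.

Lemma eqmod2E (x y : int) : eqmod2 x y = (2 %| x - y)%Z.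
Proof. by rewrite /eqmod2 eqz_mod_dvd. Qed.

Lemma binary_modz2 (x : int) : (x %% 2)%Z = 0 \/ (x %% 2)%Z = 1.
Proof.
have := modz_ge0 x (isT : 2 != 0 :> int).
have := ltz_pmod x (isT : 0 < 2 :> int).
by case: (x %% 2)%Z => [[|[|n]]|n] //=; [left | right].
Qed.

Lemma eqmod2_binary (x y : int) :
  x = 0 \/ x = 1 -> y = 0 \/ y = 1 -> eqmod2 x y -> x = y.
Proof. by move=> [] -> [] ->. Qed.

Section ExistsA.
Variables (f : fps) (f0 : f 0%N = 0) (f1 : eqmod2 (f 1%N) 1).

Lemma eqmod2_diag (x : int) (k : nat) : eqmod2 (x * fps_exp f k k) x.
Proof.
rewrite /eqmod2 fps_exp_diag // -modzMmr -modzXm.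
by move/eqP: f1 => ->; rewrite modzXm expr1n modzMmr mulr1.
Qed.

Lemma binary_A_sequence_unique (A B : fps) :
  binary_A_sequence f A -> binary_A_sequence f B -> A =1 B.
Proof.
move=> [bA eA] [bB eB] k; elim/ltn_ind: k => k IHk.
apply: eqmod2_binary (bA k) (bB k) _.
have := eA k.+1; have := eB k.+1; rewrite /= /fps_comp !big_ord_recr /=.
rewrite (eq_bigr (fun i : 'I_k => A i * fps_exp f i k)) => [|i _]; last first.
  by rewrite IHk.
set s := \sum_(i < k) _.
move=> /eqP fB /eqP fA.
have /eqP := etrans (esym fA) fB.
rewrite eqz_modDl => eAB.
move: (eqmod2_diag (A k) k) (eqmod2_diag (B k) k) => /eqP dA /eqP dB.
by rewrite /eqmod2 -dA (eqP eAB) dB.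
Qed.

Fixpoint A_prefix (m : nat) : seq int :=
  if m is k.+1 then
    let s := A_prefix k in
    rcons s ((f k.+1 - \sum_(j < k) s`_j * fps_exp f j k) %% 2)%Z
  else [::].

Lemma size_A_prefix m : size (A_prefix m) = m.
Proof. by elim: m => //= m IHm; rewrite size_rcons IHm. Qed.

Lemma nth_A_prefix m k : (k < m)%N -> (A_prefix m)`_k = (A_prefix k.+1)`_k.
Proof.
elim: m => // m IHm; rewrite ltnS leq_eqVlt => /predU1P[->//|ltkm].
by rewrite [A_prefix m.+1]/= nth_rcons size_A_prefix ltkm IHm.
Qed.

Lemma binary_A_sequence_exists : exists A, binary_A_sequence f A.
Proof.
pose A k := (A_prefix k.+1)`_k.
have AE k : A k = ((f k.+1 - \sum_(j < k) A j * fps_exp f j k) %% 2)%Z.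
  rewrite /A /= nth_rcons size_A_prefix ltnn eqxx.
  congr ((_ - _) %% _)%Z; apply: eq_bigr => j _.
  by rewrite nth_A_prefix.
exists A; split=> [k|[|k]]; first by rewrite AE; apply: binary_modz2.
  by rewrite /eqmod2 f0.
rewrite /= /fps_comp big_ord_recr /=; set s := \sum_(i < k) _.
have /eqP d := eqmod2_diag (A k) k.
rewrite /eqmod2 -modzDmr d AE modz_mod modzDmr -/s.
by rewrite addrC subrK.
Qed.

End ExistsA.

(* Main.v *)
Require Import Defs.
From mathcomp Require Import all_boot all_order all_algebra.
From mathcomp Require Import zify ring.

Set Implicit Arguments.
Unset Strict Implicit.
Unset Printing Implicit Defensive.

Import Order.TTheory GRing.Theory Num.Theory.
Local Open Scope ring_scope.

(** The mechanism is the differential equation f = (t + t^2) f', read modulo 2.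
In characteristic 2 a derivative has only even powers of t and squaring is
u(t)^2 = u(t^2), so a coefficient of index 2k of u^2 is the coefficient of
index k of u.  Put D = f + t f' + t^2 f', which also has only even powers.

The odd vertices are always independent: their entries are odd-indexed
coefficients of f' (f^b)^2, a product of series in t^2 ([odd_edge]).

For the even vertices, f f' = D f' + t f'^2 + t^2 f'^2, so that
  [t^(2c+2)] f' f^(2b+1) = [t^c] f' f^b + [t^(2c+2)] D f' f^(2b).
Hence D = 0 makes a |-> 2a an isomorphism onto the even vertices.  Conversely,
suppose that D has order exactly 2(m+1).  Then the two adjacency relations on
{1, ..., m+2} differ at the single pair {1, m+2} ([even_edge]): one of the
graphs is obtained from the other by deleting an edge.  They have different
numbers of edges, so that no bijection whatsoever is an isomorphism
([subrel_iso_eq]), and the vertex count n = 2(m+2) refutes decomposability.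

Finally f = t A(f) gives f' = A(f) + t A'(f) f', whence D = t^2 f' (A' - 1)(f).
As f has order 1 and f' is invertible, D = 0 if and only if A' = 1
([dvd_ode_defect_comp]).

Power series are replaced by their truncations, polynomials over the field
with two elements; to vanish up to order N is to be divisible by 'X^N. *)

(** * Polynomials over the field with two elements *)

Notation F2 := 'F_2.

Lemma eqmod2_F2 (x y : int) : eqmod2 x y = (x%:~R == y%:~R :> F2).
Proof.
by rewrite eqmod2E (dvdz_pcharf (pchar_Fp (isT : prime 2))) rmorphB subr_eq0.
Qed.

Lemma F2_01 (a : F2) : a = 0 \/ a = 1.
Proof. by case: a => [[|[|]] //] i; [left | right]; apply: val_inj. Qed.

Lemma addFF (a : F2) : a + a = 0.
Proof. exact: addrr_pchar2 (pchar_Fp (isT : prime 2)) a. Qed.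

Lemma mulrn_oddF (a : F2) k : a *+ k.*2.+1 = a.
Proof. by rewrite mulrS -mul2n mulrnA [_ *+ 2]addFF mul0rn addr0. Qed.

Lemma pchar_polyF2 : 2 \in [pchar {poly F2}].
Proof. by rewrite pchar_poly; apply: (pchar_Fp (isT : prime 2)). Qed.

Lemma addpp (p : {poly F2}) : p + p = 0.
Proof. exact: addrr_pchar2 pchar_polyF2 p. Qed.

Lemma dvdXnP (N : nat) (p : {poly F2}) :
  reflect (forall k, (k < N)%N -> p`_k = 0) ('X^N %| p).
Proof.
apply: (iffP idP) => [/dvdpP[q ->] k ltkN | p0]; first by rewrite coefMXn ltkN.
rewrite -[p](poly_take_drop N) (_ : take_poly N p = 0) ?add0r ?dvdp_mull //.
by apply/polyP => k; rewrite coef_take_poly coef0; case: ltnP => // /p0.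
Qed.

Lemma Gauss_dvdXn (N : nat) (p q : {poly F2}) :
  q`_0 = 1 -> ('X^N %| q * p) = ('X^N %| p).
Proof.
move=> q0; apply/Gauss_dvdpr/coprimep_expl.
by rewrite coprimep_sym coprimepX /root horner_coef0 q0.
Qed.

Lemma dvdX_ex (p : {poly F2}) : p`_0 = 0 -> exists u, p = 'X * u.
Proof.
move=> p0; have /dvdpP[u ->] : 'X^1 %| p by apply/dvdXnP; case.
by exists u; rewrite mulrC.
Qed.

Lemma coef0_comp (p q : {poly F2}) : q`_0 = 0 -> (p \Po q)`_0 = p`_0.
Proof. by move=> q0; rewrite -!horner_coef0 horner_comp (horner_coef0 q) q0. Qed.

Lemma coef0_exp (u : {poly F2}) n : u`_0 = 1 -> (u ^+ n)`_0 = 1.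
Proof. by move=> u0; rewrite -horner_coef0 horner_exp horner_coef0 u0 expr1n. Qed.

(** Substituting a series of order 1 preserves the order of vanishing: if
p = 'X^N * c and q = 'X * u with u(0) = 1, then p(q) = 'X^N * u^N * c(q), whose
coefficient of index N is c(0). *)
Lemma dvdXn_comp (N : nat) (p q : {poly F2}) :
  q`_0 = 0 -> q`_1 = 1 -> 'X^N %| p \Po q -> 'X^N %| p.
Proof.
move=> q0 q1; have [u qE] := dvdX_ex q0.
have u0 : u`_0 = 1 by rewrite -q1 qE mulrC coefMX.
elim: N => [_|N IHN dv]; first exact: dvd1p.
have /dvdpP[c cE] : 'X^N %| p.
  by apply/IHN/(dvdp_trans _ dv); rewrite dvdp_exp2l.
have : 'X^(N.+1) %| 'X^N * (u ^+ N * (c \Po q)).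
  move: dv; rewrite cE comp_polyM comp_Xn_poly {2}qE exprMn.
  by congr (_ %| _); ring.
rewrite exprSr dvdp_mul2l ?expf_neq0 ?polyX_eq0 // -['X]expr1 Gauss_dvdXn.
  move=> /dvdXnP/(_ 0%N isT); rewrite coef0_comp // => c0.
  by rewrite cE [c * _]mulrC dvdp_mul2l ?expf_neq0 ?polyX_eq0 //;
    apply/dvdXnP; case.
exact: coef0_exp.
Qed.

(** Frobenius: the coefficients are fixed by squaring. *)
Lemma sqr_comp (p : {poly F2}) : p ^+ 2 = p \Po 'X^2.
Proof.
elim/poly_ind: p => [|p c IHp]; first by rewrite comp_poly0 expr0n.
rewrite comp_poly_MXaddC -IHp.
have -> : (p * 'X + c%:P) ^+ 2
  = p ^+ 2 * 'X^2 + c%:P ^+ 2 + (p * 'X * c%:P + p * 'X * c%:P) by ring.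
rewrite addpp addr0 -polyC_exp; congr (_ + _%:P).
by case: (F2_01 c) => ->; rewrite ?expr0n ?expr1n.
Qed.

Lemma coef_sqr_even (p : {poly F2}) k : (p ^+ 2)`_k.*2 = p`_k.
Proof.
by rewrite sqr_comp coef_comp_poly_Xn // -muln2 dvdn_mull // mulnK.
Qed.

Lemma coef_deriv_even (p : {poly F2}) k : p^`()`_k.*2 = p`_k.*2.+1.
Proof. by rewrite coef_deriv mulrn_oddF. Qed.

(** Vanishing of the derivative is how evenness of a series is expressed below:
it is stable under products by the Leibniz rule. *)
Lemma coef_odd_deriv0 (p : {poly F2}) k : p^`() = 0 -> p`_k.*2.+1 = 0.
Proof. by move=> dp0; rewrite -coef_deriv_even dp0 coef0. Qed.

Lemma deriv_sqr (p : {poly F2}) : (p ^+ 2)^`() = 0.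
Proof. by rewrite deriv_exp mulr2n addpp. Qed.

Lemma deriv2 (p : {poly F2}) : p^`()^`() = 0.
Proof. by rewrite -[LHS]/(p^`(2)) nderivn_def mulr2n addpp. Qed.

(** * The equation f = (t + t^2) f' *)

(** The obstruction D to p = (t + t^2) p', with minus signs turned into plus. *)
Definition ode_defect (p : {poly F2}) := p + 'X * p^`() + 'X^2 * p^`().

Lemma coef_ode_defect0 p : (ode_defect p)`_0 = p`_0.
Proof. by rewrite !coefD coefXM coefXnM !addr0. Qed.

Lemma coef_ode_defect_even p m :
  (ode_defect p)`_m.*2.+2 = p`_m.*2.+2 + p`_m.*2.+1.
Proof.
rewrite !coefD coefXM coefXnM /= subn2 /= coef_odd_deriv0 ?deriv2 // addr0.
by rewrite coef_deriv_even.
Qed.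

Lemma deriv_ode_defect p : (ode_defect p)^`() = 0.
Proof.
rewrite !derivD !derivM deriv2 !mulr0 derivX !mul1r mulr1 !addr0 !addpp.
by rewrite mul0r addr0.
Qed.

(** With q = p' p^b, multiplying p p' = D p' + t p'^2 + t^2 p'^2 by p^(2b)
gives D p' p^(2b) + t q^2 + (t q)^2.  The middle term has only odd powers, and
the last one contributes the coefficient of index c + 1 of t q. *)
Lemma coef_double_edge p b c :
  (p^`() * p ^+ b.*2.+1)`_c.*2.+2
  = (p^`() * p ^+ b)`_c + (ode_defect p * (p^`() * p ^+ b.*2))`_c.*2.+2.
Proof.
set q := p^`() * p ^+ b.
have -> : p^`() * p ^+ b.*2.+1
  = ('X * q) ^+ 2 + 'X * q ^+ 2 + ode_defect p * (p^`() * p ^+ b.*2).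
  have pE : p = ode_defect p + 'X * p^`() + 'X^2 * p^`().
    by rewrite /ode_defect; ring: (addpp ('X * p^`())) (addpp ('X^2 * p^`())).
  rewrite exprS {2}pE /q -muln2 exprM; ring.
rewrite !coefD -[in LHS]doubleS coef_sqr_even coefXM /= doubleS coefXM /=.
by rewrite coef_odd_deriv0 ?deriv_sqr // addr0.
Qed.

Lemma coef_odd_edge (p : {poly F2}) b c : (p^`() * p ^+ b.*2)`_c.*2.+1 = 0.
Proof.
by apply: coef_odd_deriv0;
  rewrite derivM deriv2 -muln2 exprM deriv_sqr mul0r mulr0 addr0.
Qed.

(** The factors D, p' and p^(2b) have orders at least 2r, exactly 0 and exactly
2b, and p' and p have leading coefficient 1. *)
Lemma coef_defect_edge (p : {poly F2}) r b c :
  p`_0 = 0 -> p`_1 = 1 -> 'X^(r.*2) %| ode_defect p -> (c <= r + b)%N ->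
  (ode_defect p * (p^`() * p ^+ b.*2))`_c.*2
  = if c == (r + b)%N then (ode_defect p)`_r.*2 else 0.
Proof.
move=> p0 p1 /dvdpP[d dE]; have [u pE] := dvdX_ex p0.
have u0 : u`_0 = 1 by rewrite -p1 pE mulrC coefMX.
have dp0 : p^`()`_0 = 1 by rewrite coef_deriv p1.
rewrite dE {2}pE => lec.
have -> : d * 'X^(r.*2) * (p^`() * ('X * u) ^+ b.*2)
  = (d * (p^`() * u ^+ b.*2)) * 'X^((r + b).*2).
  by rewrite doubleD exprD exprMn; ring.
rewrite !coefMXn ltnn subnn ltn_double.
case: eqVneq => [->|nec]; last by rewrite ltn_neqAle nec lec.
by rewrite ltnn subnn -!horner_coef0 !hornerM !horner_coef0 dp0 coef0_exp // !mulr1.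
Qed.

(** Since D is even, only the coefficients of index 2m + 2 count, and in these
the term t p' is silent. *)
Lemma dvd_ode_defectP n (p : {poly F2}) : p`_0 = 0 ->
  reflect (forall m, (m.*2.+2 < n)%N -> p`_m.*2.+2 = p`_m.*2.+1)
          ('X^n %| ode_defect p).
Proof.
move=> p0; apply: (iffP (dvdXnP _ _)) => [D0 m ltmn | pE k ltkn].
  have /eqP := D0 _ ltmn; rewrite coef_ode_defect_even addr_eq0 => /eqP ->.
  exact: oppr_pchar2 (pchar_Fp (isT : prime 2)) _.
have [kodd | keven] := boolP (odd k).
  by rewrite -(odd_double_half k) kodd coef_odd_deriv0 // deriv_ode_defect.
case: k ltkn keven => [|[//|k]] ltkn keven; first by rewrite coef_ode_defect0.
have kE : k = k./2.*2 by rewrite even_halfK //; move: keven; rewrite /= negbK.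
by rewrite kE coef_ode_defect_even pE -?kE // addFF.
Qed.

(** Differentiating p = 'X * q(p) and eliminating q(p) yields
D = 'X^2 * p' * (q' - 1)(p).  The truncation error t of the functional equation
only adds t + 'X * t', still divisible by 'X^(n.+2): the factor 'X makes up for
the order lost in the derivative. *)
Lemma dvd_ode_defect_comp n (p q : {poly F2}) :
  p`_0 = 0 -> p`_1 = 1 -> 'X^(n.+2) %| p - 'X * (q \Po p) ->
  ('X^(n.+2) %| ode_defect p) = ('X^n %| q^`() - 1).
Proof.
move=> p0 p1 /dvdpP[e eE].
set t := e * 'X^(n.+2).
have dp : p^`() = q \Po p + 'X * ((q^`() \Po p) * p^`()) + t^`().
  rewrite -{1}[p](subrK ('X * (q \Po p))) eE derivD derivM derivX deriv_comp.
  by rewrite mul1r addrC.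
have -> : ode_defect p
  = 'X^2 * (p^`() * ((q^`() - 1) \Po p)) + (t + 'X * t^`()).
  have pE : p = t + 'X * (q \Po p) by rewrite /t -eE subrK.
  set a := q \Po p in dp pE *; set b := q^`() \Po p in dp *.
  rewrite comp_polyB -/b comp_polyC polyC1.
  rewrite /ode_defect {1}pE.
  have -> : 'X * p^`() = 'X * a + 'X^2 * (b * p^`()) + 'X * t^`().
    by rewrite {1}dp; ring.
  apply/eqP; rewrite -subr_eq0; apply/eqP.
  rewrite -[RHS]addr0 -{1}(addpp ('X * a)) -(addpp ('X^2 * p^`())).
  by ring.
have -> : t + 'X * t^`() = (e + 'X * e^`() + e *+ n.+2) * 'X^(n.+2).
  by rewrite /t derivM derivXn /= mulrnAr -mulrnAl !['X^(n.+2)]exprS; ring.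
rewrite (dvdp_addl _ (dvdp_mull _ (dvdpp _))).
rewrite ((exprD _ 2 n) : 'X^(n.+2) = 'X^2 * 'X^n) dvdp_mul2l ?expf_neq0 ?polyX_eq0 //.
rewrite Gauss_dvdXn ?coef_deriv ?p1 //.
apply/idP/idP; first exact: dvdXn_comp.
case/dvdpP => d ->; rewrite comp_polyM comp_Xn_poly dvdp_mull // dvdp_exp2r //.
by have [u {1}->] := dvdX_ex p0; rewrite dvdp_mulr.
Qed.

(** * Truncation of power series modulo 2 *)

Definition represents (N : nat) (p : {poly F2}) (u : fps) :=
  forall k, (k < N)%N -> p`_k = (u k)%:~R.

Definition trunc (N : nat) (u : fps) : {poly F2} := \poly_(k < N) (u k)%:~R.

Lemma trunc_repr N u : represents N (trunc N u) u.
Proof. by move=> k ltkN; rewrite coef_poly ltkN. Qed.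

Lemma mul_repr N p q u v :
  represents N p u -> represents N q v -> represents N (p * q) (fps_mul u v).
Proof.
move=> pu qv k ltkN; rewrite coefM rmorph_sum; apply: eq_bigr => [[i /= lti]] _.
by rewrite rmorphM pu ?qv //; lia.
Qed.

Lemma exp_repr N p u j : represents N p u -> represents N (p ^+ j) (fps_exp u j).
Proof.
move=> pu; elim: j => [|j IHj]; last by rewrite exprS; apply: mul_repr.
by move=> k _; rewrite coef1 /fps_exp /= /fps_one; case: eqP.
Qed.

Lemma deriv_repr N p u : represents N.+1 p u -> represents N p^`() (fps_deriv u).
Proof. by move=> pu k ltkN; rewrite coef_deriv pu // /fps_deriv rmorphMn. Qed.

(** The sum that defines the coefficient of index k of u(f) stops at j = k,
while the truncation of u brings in all j < N: the additional powers of f have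
order greater than k. *)
Lemma comp_repr N p u f :
  f 0%N = 0 -> represents N p f -> represents N (trunc N u \Po p) (fps_comp u f).
Proof.
move=> f0 pf k ltkN; rewrite /trunc poly_def raddf_sum coef_sum rmorph_sum /=.
rewrite [RHS](big_ord_widen _ (fun j => (u j * fps_exp f j k)%:~R : F2) ltkN).
rewrite [RHS]big_mkcond.
apply: eq_bigr => j _; rewrite comp_polyZ comp_Xn_poly coefZ (exp_repr j pf) //.
case: ltnP => [_|ltkj]; first by rewrite rmorphM.
by rewrite fps_exp_small ?mulr0.
Qed.

(** * Edges of the graph of (f', f) *)

(** The coefficient of index 2m + 2 of f = (t + t^2) f', modulo 2; the other
coefficients of this equation hold for every f with f(0) = 0. *)
Definition paired (f : fps) (m : nat) : bool := eqmod2 (f m.*2.+2) (f m.*2.+1).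

Section DerivativeGraph.
Variables (f : fps) (f0 : f 0%N = 0) (f1 : eqmod2 (f 1%N) 1).

Lemma coef0_trunc N : (trunc N f)`_0 = 0.
Proof. by rewrite coef_poly f0; case: ifP. Qed.

Lemma coef1_trunc N : (1 < N)%N -> (trunc N f)`_1 = 1.
Proof. by move=> N1; rewrite trunc_repr //; move: f1; rewrite eqmod2_F2 => /eqP. Qed.

Lemma riordan_edge_coef N p b c : represents N p f -> (c.+1 < N)%N ->
  riordan_edge (fps_deriv f) f c.+2 b.+1 = ((p^`() * p ^+ b)`_c == 1).
Proof.
case: N => // N pf ltcN; rewrite /riordan_edge eqmod2_F2 subn1 subn2 /=.
have pf' : represents N p f by move=> k ltkN; apply: pf; apply: ltnW.
by rewrite (mul_repr (deriv_repr pf) (exp_repr b pf')).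
Qed.

Lemma odd_edge b c : riordan_edge (fps_deriv f) f c.*2.+3 b.*2.+1 = false.
Proof.
by rewrite (@riordan_edge_coef c.*2.+3 _ _ _ (@trunc_repr _ f)) ?coef_odd_edge.
Qed.

(** If m is the first index at which f = (t + t^2) f' fails, then D has order
2(m + 1), and doubling the labels flips exactly the entries on the diagonal
c = m + b among those with c <= m + b. *)
Lemma even_edge m b c :
  (forall k, (k < m)%N -> paired f k) -> (c <= m + b)%N ->
  riordan_edge (fps_deriv f) f c.+2.*2 b.+1.*2
  = riordan_edge (fps_deriv f) f c.+2 b.+1
    (+) (c == m + b)%N && ~~ paired f m.
Proof.
move=> fm lec; pose N := (c.*2 + m.*2 + 4)%N; have pf := @trunc_repr N f.
have ltN k : (k <= c.*2 + m.*2 + 3)%N -> (k < N)%N by rewrite /N; lia.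
(* The labels 2(c + 2) and 2(b + 1) are (2c + 2) + 2 and (2b + 1) + 1. *)
rewrite (@riordan_edge_coef N _ b.*2.+1 c.*2.+2 pf) ?(riordan_edge_coef _ pf);
  [|apply: ltN; lia|apply: ltN; lia].
rewrite coef_double_edge -doubleS (@coef_defect_edge _ m.+1) ?coef0_trunc //; first last.
- apply/dvd_ode_defectP; rewrite ?coef0_trunc // => k ltk.
  rewrite !pf; [|apply: ltN; lia|apply: ltN; lia].
  by apply/eqP; rewrite -eqmod2_F2; apply: fm; lia.
- by rewrite coef1_trunc //; apply: ltN; lia.
rewrite addSn eqSS; set x := (_ * _ : {poly F2})`_c.
case: ifP => [_|_]; last by rewrite addr0 addbF.
rewrite doubleS coef_ode_defect_even !pf /paired ?eqmod2_F2; [|apply: ltN; lia|apply: ltN; lia].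
case: (F2_01 x) => ->; case: (F2_01 (f m.*2.+2)%:~R) => ->;
  by case: (F2_01 (f m.*2.+1)%:~R) => ->.
Qed.

Lemma A_sequence_paired A : binary_A_sequence f A ->
  (forall m, paired f m) <-> fps_eqmod2 (fps_deriv A) fps_one.
Proof.
move=> [_ fA].
have dvdA n : ('X^(n.+2) %| ode_defect (trunc n.+2 f))
            = ('X^n %| (trunc n.+2 A)^`() - 1).
  have pf := @trunc_repr n.+2 f; have p0 := coef0_trunc n.+2.
  apply: (dvd_ode_defect_comp p0 (@coef1_trunc n.+2 isT)).
  apply/dvdXnP => -[|k] ltk; rewrite coefB coefXM /= ?subr0 // pf //.
  rewrite (comp_repr _ f0 pf) 1?ltnW //.
  by have := fA k.+1; rewrite eqmod2_F2 => /eqP ->; rewrite subrr.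
have coefA n k : (k < n)%N ->
    (((trunc n.+2 A)^`() - 1)`_k == 0) = eqmod2 (fps_deriv A k) (fps_one k).
  move=> ltkn; rewrite coefB (deriv_repr (@trunc_repr _ A)) 1?ltnW // coef1.
  by rewrite subr_eq0 eqmod2_F2 /fps_one rmorph_nat.
split=> [fE k | AE m].
  rewrite -(coefA k.+1) //; apply/eqP/(dvdXnP k.+1) => //.
  rewrite -dvdA; apply/dvd_ode_defectP => [|m ltm]; first exact: coef0_trunc.
  by rewrite !trunc_repr ?(ltnW ltm) //; apply/eqP; rewrite -eqmod2_F2; apply: fE.
have : 'X^(m.*2.+3) %| ode_defect (trunc m.*2.+3 f).
  by rewrite dvdA; apply/dvdXnP => k ltk; apply/eqP; rewrite coefA.
move=> /(dvd_ode_defectP _ (coef0_trunc _)) /(_ m (ltnSn _)).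
by rewrite !trunc_repr // /paired eqmod2_F2 => ->.
Qed.

End DerivativeGraph.

(** * Isomorphism with the graph on the even vertices *)

(** Isomorphic finite relations have equally many related pairs, so that neither
can be strictly contained in the other. *)
Lemma subrel_iso_eq (T : finType) (e e' : rel T) (h : T -> T) :
  bijective h -> (forall x y, e (h x) (h y) = e' x y) ->
  subrel e e' \/ subrel e' e -> e =2 e'.
Proof.
move=> [h' hK h'K] he sub x y.
pose E (r : rel T) := [set z : T * T | r z.1 z.2].
have cardE : #|E e| = #|E e'|.
  rewrite -(card_imset (E e') (f := fun z => (h z.1, h z.2))); last first.
    by move=> [a b] [c d] [/(can_inj hK) -> /(can_inj hK) ->].
  apply: eq_card => -[a b]; rewrite !inE; apply/idP/imsetP => [eab | [[c d]]].
    by exists (h' a, h' b); rewrite ?inE /= -?he !h'K.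
  by rewrite inE -he => ecd [-> ->].
suff /setP/(_ (x, y)) : E e = E e' by rewrite !inE.
case: sub => sub; [|symmetry]; apply/eqP; rewrite eqEcard cardE leqnn andbT;
  by apply/subsetP => z; rewrite !inE; apply: sub.
Qed.

Lemma riordan_adj_gt m (g f : fps) (x y : 'I_m) : (y < x)%N ->
  riordan_adj g f x y = riordan_edge g f x.+1 y.+1.
Proof. by move=> ltyx; rewrite /riordan_adj /label !ltnS ltyx ltnNge ltnW // orbF. Qed.

Section EvenVertices.
Variables (n : nat) (g f : fps).

(* The vertex labelled a is the ordinal a - 1, and doubling its label gives the
   ordinal 2a - 1. *)
Lemma double_subproof (y : 'I_n./2) : (y.*2.+1 < n)%N.
Proof. by have := ltn_ord y; lia. Qed.

Definition double_vertex (y : 'I_n./2) : 'I_n := Ordinal (double_subproof y).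

Lemma graph_iso_even :
  graph_iso (induced (even_vertices n g f)) (riordan_graph n./2 g f) <->
  exists2 h : 'I_n./2 -> 'I_n./2, bijective h &
    forall y z, riordan_adj g f (h y) (h z)
                = riordan_adj g f (double_vertex y) (double_vertex z).
Proof.
have even_double y : double_vertex y \in even_vertices n g f.
  by rewrite inE /label /= odd_double.
pose psi y : induced (even_vertices n g f) :=
  exist (fun x => x \in even_vertices n g f) _ (even_double y).
have half_lt (x : induced (even_vertices n g f)) : ((val x : 'I_n)./2 < n./2)%N.
  case: x => x /=; rewrite inE /label /=; have := ltn_ord x; lia.
pose phi x : 'I_n./2 := Ordinal (half_lt x).
have psiK : cancel psi phi by move=> y; apply: val_inj; rewrite /= uphalf_double.
have phiK : cancel phi psi.
  move=> x; do 2 apply: val_inj => /=; case: x => x /=.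
  by rewrite inE /label /=; lia.
split=> [[h hbij hadj] | [h hbij hadj]].
  exists (h \o psi); first by apply: bij_comp hbij _; exists phi.
  by move=> y z; apply: hadj.
exists (h \o phi); first by apply: bij_comp hbij _; exists psi.
by move=> x y; rewrite -{2}[x]phiK -{2}[y]phiK; apply: hadj.
Qed.

End EvenVertices.

Section DerivativeGraphIso.
Variables (f : fps) (f0 : f 0%N = 0) (f1 : eqmod2 (f 1%N) 1).
Let f' := fps_deriv f.

Lemma even_adj n m (y z : 'I_n./2) :
  (forall k, (k < m)%N -> paired f k) ->
  (z < y)%N -> (y <= (m + z).+1)%N ->
  riordan_adj f' f (double_vertex y) (double_vertex z)
  = riordan_adj f' f y z
    (+) (y == (m + z).+1 :> nat) && ~~ paired f m.
Proof.
move=> fm ltzy ley; rewrite !riordan_adj_gt //=; last by lia.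
case: (nat_of_ord y) ltzy ley => // c ltzc lec.
by rewrite -!doubleS (even_edge f0 f1 fm) ?eqSS.
Qed.

Lemma decomposable_paired :
  (forall m, paired f m)
  <-> forall n, (1 <= n)%N -> ie_decomposable n f' f.
Proof.
split=> [fE n _ | dec].
  have f'0 : eqmod2 (f' 0%N) 1 by rewrite /f' /fps_deriv.
  split=> //.
    have odd0 (x y : 'I_n) : odd (label x) -> odd (label y) -> (y < x)%N ->
        riordan_adj f' f x y = false.
      move=> ox oy ltyx; rewrite riordan_adj_gt //.
      have -> : x = ((x : nat).-2)./2.*2.+2 :> nat by move: ox oy; rewrite /label; lia.
      have -> : y = (y : nat)./2.*2 :> nat by move: ox oy; rewrite /label; lia.
      exact: odd_edge.
    move=> [x xo] [y yo]; rewrite /= /induced_adj /=; move: xo yo; rewrite !inE => xo yo.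
    case: (ltngtP x y) => [ltxy|ltyx|/val_inj ->].
    - by rewrite riordan_adj_sym odd0.
    - by rewrite odd0.
    - by rewrite riordan_adj_irrefl.
  apply/graph_iso_even; exists id; first by exists id.
  have even (y z : 'I_n./2) : (z < y)%N -> riordan_adj f' f y z
      = riordan_adj f' f (@double_vertex n y) (double_vertex z).
    move=> ltzy; rewrite (@even_adj n y) //; last by lia.
    by rewrite fE andbF addbF.
  move=> y z; case: (ltngtP y z) => [ltyz|ltzy|/val_inj ->].
  - by rewrite riordan_adj_sym even // riordan_adj_sym.
  - exact: even.
  - by rewrite !riordan_adj_irrefl.
(* At the first m with [~~ paired f m], the graphs with m + 2 vertices differ
   at the pair of their extreme vertices only. *)
move=> m; elim/ltn_ind: m => m IHm; apply/negPn/negP => fmN.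
pose n := m.+2.*2.
have [_ _ /graph_iso_even[h hbij hadj]] := dec n isT.
have n2 : n./2 = m.+2 by rewrite /n doubleK.
have lt2 (y : 'I_n./2) : (y < m.+2)%N by rewrite -n2.
pose y0 : 'I_n./2 := Ordinal (etrans (congr1 (leq 1) n2) isT).
have lt1 : (m.+1 < n./2)%N by rewrite n2.
pose y1 : 'I_n./2 := Ordinal lt1.
pose e y z := riordan_adj f' f (y : 'I_n./2) z.
pose e' y z := riordan_adj f' f (@double_vertex n y) (double_vertex z).
pose last (y z : 'I_n./2) := (y == y1) && (z == y0).
have e'gt (y z : 'I_n./2) : (z < y)%N -> e' y z = e y z (+) (last y z).
  move=> ltzy; rewrite /e' (@even_adj n m) //; last by have := lt2 y; lia.
  rewrite fmN andbT; congr (_ (+) _); rewrite /last -!val_eqE /=.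
  by move: (lt2 y) ltzy; move: (nat_of_ord y) (nat_of_ord z) => a b; clear; lia.
have last_le (y z : 'I_n./2) : (y <= z)%N -> last y z = false.
  by move=> leyz; apply/negP => /andP[/eqP yE /eqP zE]; rewrite yE zE in leyz.
have e'E y z : e' y z = e y z (+) (last y z || last z y).
  case: (ltngtP y z) => [ltyz|ltzy|/val_inj ->].
  - rewrite (last_le y) 1?ltnW //= /e' /e riordan_adj_sym -/(e' z y) e'gt //.
    by rewrite /e riordan_adj_sym.
  - by rewrite (last_le z) 1?ltnW // orbF e'gt.
  - by rewrite /e' /e !riordan_adj_irrefl last_le.
(* The differing pair is an edge of one of the two graphs, which therefore
   contains the other. *)
have sub : subrel e e' \/ subrel e' e.
  have e10 y z : last y z || last z y -> e y z = e y1 y0.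
    by case/orP => /andP[/eqP -> /eqP ->] //; apply: riordan_adj_sym.
  case E : (e y1 y0); [right | left] => y z; rewrite e'E;
    by case: (boolP (last y z || last z y)) => [/e10 ->|_]; rewrite ?E ?addbF.
have eE : e =2 e' := subrel_iso_eq hbij hadj sub.
by have := eE y1 y0; rewrite e'E /last !eqxx /=; case: (e y1 y0).
Qed.

End DerivativeGraphIso.

(** * The shape of the A-sequence *)

(** In A' the odd coefficients vanish modulo 2, and the one of index 2k is that
of index 2k + 1 in A; the first term is f'(0), by f = t A(f). *)
Lemma ie_formP (f A : fps) : f 0%N = 0 -> eqmod2 (f 1%N) 1 ->
  binary_A_sequence f A -> ie_form A <-> fps_eqmod2 (fps_deriv A) fps_one.
Proof.
move=> f0 f1 [binA fA].
have A0 : A 0%N = 1.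
  apply: eqmod2_binary (binA 0%N) (or_intror erefl) _; rewrite eqmod2_F2.
  have := fA 1%N; rewrite /= /fps_comp big_ord1 mulr1 eqmod2_F2 => /eqP <-.
  by rewrite -eqmod2_F2.
have odd_deriv k : eqmod2 (fps_deriv A k.*2.+1) 0.
  rewrite eqmod2_F2 /fps_deriv -doubleS -mul2n mulrnA rmorphMn rmorphMn.
  by rewrite [_ *+ 2]addFF mul0rn.
have even_deriv k x : eqmod2 (fps_deriv A k.*2) x = eqmod2 (A k.*2.+1) x.
  by rewrite !eqmod2_F2 /fps_deriv rmorphMn mulrn_oddF.
split=> [[_ A1 Aodd] k | dA].
  rewrite -(odd_double_half k); case: (odd k); first exact: odd_deriv.
  rewrite even_deriv; case: k./2 => [|j]; first by rewrite A1.
  by rewrite (Aodd j.+1 isT).2.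
split=> // [|i i1].
  by apply: eqmod2_binary (binA _) (or_intror erefl) _; rewrite -(even_deriv 0%N).
split=> //; apply: eqmod2_binary (binA _) (or_introl erefl) _.
by rewrite -even_deriv; case: i i1 => // i _; apply: dA.
Qed.

Theorem theorem4p26 (f A : fps)
    (f0 : f 0%N = 0%R)
    (f'0 : eqmod2 (fps_deriv f 0%N) 1%R)
    (fA : binary_A_sequence f A) :
  ((forall n : nat, (1 <= n)%N -> ie_decomposable n (fps_deriv f) f)
     <-> ie_form A)
  /\ (ie_form A <-> fps_eqmod2 (fps_deriv A) fps_one).
Proof.
have AE := ie_formP f0 f'0 fA; split=> //.
by rewrite AE -(A_sequence_paired f0 f'0 fA) (decomposable_paired f0 f'0).
Qed.
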